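(* Let $\Lambda\subset\mathbb{S}^n$ be a closed set, let $X$ be a uniformly distributed set of bounded type in $H(\Lambda)$, let $\Delta=\Delta(X)$, and let $\{\mu_z\}_{z\in\mathbb{B}^{n+1}}$ be the Patterson measure for $X$, with uniformly bounded total mass $\sigma(\mu_z)\leq K$. Fix a radius $\ell>0$. Then there exists a constant $A>0$ depending only on $K$ and $\ell$ such that for every $x\in X\setminus\{o\}$ the diameter of the shadow $S(x,\ell)$ satisfies $$A\,(\mathrm{diam}\,S(x,\ell))^{\Delta}\geq\mu_o(S(x,\ell)).$$
   Context: Let $n\ge1$ (fixed). $(\mathbb{B}^{n+1},d)$ is the unit ball model of hyperbolic space with origin $o$ and boundary at infinity $\mathbb{S}^n$; $B_R(z)$ is the hyperbolic ball of centre $z$ and radius $R$, $\#$ is cardinality. For a closed $\Lambda\subset\mathbb{S}^n$, the convex hull $H(\Lambda)\subset\mathbb{B}^{n+1}$ is the hyperbolic convex hull of the union of all geodesics with both end points in $\Lambda$. A discrete set $X\subset H(\Lambda)$ is uniformly distributed if (i) there is $M<\infty$ such that every $z\in H(\Lambda)$ has some $x\in X$ with $d(x,z)\le M$, and (ii) there is $m>0$ with $d(x,x')\ge m$ for all distinct $x,x'\in X$. Put $P^s(X,z)=\sum_{x\in X}e^{-s\,d(x,z)}$ and $\Delta(X)=\inf\{s>0:P^s(X,z)<\infty\}$ (independent of $z$). $X$ is of bounded type if, assuming $o\in X$, there is $\rho\ge1$ such that $\#(X\cap B_R(x))\le\rho\,\#(X\cap B_R(o))$ for all $x\in X$, $R>0$.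 Patterson measure: a Patterson function for $X$ is a continuous non-decreasing $h:(0,\infty)\to(0,\infty)$ such that (1) $P_h^s(X,z)=\sum_{x\in X}h(d(x,z))e^{-s\,d(x,z)}$ converges for $s>\Delta(X)$ and diverges for $s\le\Delta(X)$; (2) for every $\varepsilon>0$ there is $r_0>0$ with $h(t+r)\le e^{\varepsilon t}h(r)$ for all $r\ge r_0$, $t>0$; (3) there is $C>0$ with $h(r+t)\le C\,h(r)h(t)$ for all $r,t>0$. (One may take $h\equiv1$ if $P^{\Delta}(X,z)=\infty$; $h(0)$ is read as the right limit.) For $s>\Delta(X)$ let $\mu_z^s=\frac{1}{P_h^s(X,o)}\sum_{x\in X}h(d(x,z))e^{-s\,d(x,z)}\mathbf{1}_x$, with $\mathbf1_x$ the unit point mass at $x$. A Patterson measure $\{\mu_z\}_{z\in\mathbb{B}^{n+1}}$ for $X$ is a family of weak-$*$ limits, on $\mathbb{B}^{n+1}\cup\mathbb{S}^n$, of $\mu_z^{s_j}$ along one common sequence $s_j\searrow\Delta(X)$. It is supported on $\Lambda$, its members are mutually absolutely continuous, and $\frac{d\mu_z}{d\mu_o}(\xi)=\left(\frac{1-|z|^2}{|\xi-z|^2}\right)^{\Delta}$. $\sigma(\mu_z)$ denotes the total mass; $K$ is a constant with $\sigma(\mu_z)\le K$ for all $z\in\mathbb{B}^{n+1}$. Shadows: for $x\in\mathbb{B}^{n+1}\setminus\{o\}$, $x^*\in\mathbb{S}^n$ is the end point of the geodesic ray from $x$ passing through $o$. The shadow $S(x,\ell)$ is the set of $y\in\mathbb{S}^n$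 such that the geodesic from $x^*$ to $y$ intersects the hyperbolic ball of centre $x$ and radius $\ell$. $\mathrm{diam}$ is taken in the spherical distance on $\mathbb{S}^n$. *)

(* Defs.v *)
From HB Require Import structures.
From mathcomp Require Import all_boot all_order all_algebra.
From mathcomp Require Import all_classical all_reals all_analysis.

Set Implicit Arguments.
Unset Strict Implicit.
Unset Printing Implicit Defensive.

Import Order.TTheory GRing.Theory Num.Theory.
Import numFieldNormedType.Exports.

Local Open Scope classical_set_scope.
Local Open Scope ring_scope.

(* The library norm on row vectors is the sup norm; it induces the Euclidean
   topology, but the ball model needs the Euclidean norm itself. *)
Definition edot (R : realType) (n : nat) (x y : 'rV[R]_n.+1) : R :=
  \sum_(i < n.+1) x ord0 i * y ord0 i.

Definition enorm (R : realType) (n : nat) (x : 'rV[R]_n.+1) : R :=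
  Num.sqrt (edot x x).

Section HyperbolicSpace.
Context {R : realType} {n : nat}.
Local Notation E := 'rV[R]_n.+1.
Implicit Types (x y z : E) (L C X : set E).

Definition hspace : set E := [set x | enorm x < 1].

Definition sphere : set E := [set x | enorm x = 1].

Definition cball : set E := hspace `|` sphere.

Definition arcosh (t : R) : R := ln (t + Num.sqrt (t ^+ 2 - 1)).

(* Distance of curvature -1, i.e. of the metric 2|dx| / (1 - |x|^2); meaningful
   for points of the open ball only. *)
Definition hdist x y : R :=
  arcosh (1 + 2 * enorm (x - y) ^+ 2 /
              ((1 - enorm x ^+ 2) * (1 - enorm y ^+ 2))).

Definition hball (z : E) (r : R) : set E := [set x | hspace x /\ hdist z x < r].

(* Unit speed minimizing geodesic parametrized by the interval I. *)
Definition geodesic_on (I : set R) (g : R -> E) : Prop :=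
  (forall t, I t -> hspace (g t)) /\
  (forall s t, I s -> I t -> hdist (g s) (g t) = `|s - t|).

(* Empty when the end points coincide. *)
Definition geodesic_line (xi eta : E) : set E :=
  [set x | exists g : R -> E,
     [/\ geodesic_on setT g, g t @[t --> -oo] --> xi,
         g t @[t --> +oo] --> eta & exists t, x = g t]].

Definition hconvex C : Prop :=
  C `<=` hspace /\
  forall (a : R) (g : R -> E), 0 <= a -> geodesic_on `[0, a] g ->
    C (g 0) -> C (g a) -> forall t, 0 <= t <= a -> C (g t).

Definition hull L : set E :=
  [set x | forall C, hconvex C ->
     (forall xi eta, L xi -> L eta -> geodesic_line xi eta `<=` C) -> C x].

Definition unif_distributed L X : Prop :=
  [/\ X `<=` hull L,
      forall x, X x -> exists2 r : R, 0 < r & X `&` hball x r = [set x],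
      exists M : R, forall z, hull L z -> exists2 x, X x & hdist x z <= M &
      exists2 m : R, 0 < m &
        forall x x', X x -> X x' -> x <> x' -> m <= hdist x x'].

(* The property is normalized by o \in X. *)
Definition bounded_type X : Prop :=
  X 0 /\
  exists2 rho : R, 1 <= rho &
    forall x (r : R), X x -> 0 < r ->
      (counting (X `&` hball x r) <= rho%:E * counting (X `&` hball 0 r))%E.

Definition poincare X (s : R) z : \bar R :=
  \esum_(x in X) (expR (- s * hdist x z))%:E.

(* Convergence does not depend on the base point, taken here to be o. The
   infimum is that of a nonempty set when X is uniformly distributed. *)
Definition critical_exponent X : R :=
  inf [set s : R | 0 < s /\ (poincare X s 0 < +oo)%E].

Definition modified_poincare X (h : R -> {nonneg R}) (s : R) z : \bar R :=
  \esum_(x in X) ((h (hdist x z))%:num * expR (- s * hdist x z))%:E.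

(* Only the values of h on [0, +oo[ matter; h 0 is the right limit. *)
Definition patterson_function X (h : R -> {nonneg R}) : Prop :=
  let Delta := critical_exponent X in
  [/\ [/\ {within `]0, +oo[, continuous (fun t => (h t)%:num)},
          (h t)%:num @[t --> 0^'+] --> (h 0)%:num,
          forall t, 0 < t -> 0 < (h t)%:num &
          forall t u, 0 < t -> t <= u -> (h t)%:num <= (h u)%:num],
      forall (s : R) z, hspace z ->
        (Delta < s -> (modified_poincare X h s z < +oo)%E) /\
        (s <= Delta -> modified_poincare X h s z = +oo%E),
      forall eps : R, 0 < eps -> exists2 r0 : R, 0 < r0 &
        forall r t, r0 <= r -> 0 < t ->
          (h (t + r))%:num <= expR (eps * t) * (h r)%:num &
      exists2 C : R, 0 < C &
        forall r t, 0 < r -> 0 < t ->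
          (h (r + t))%:num <= C * (h r)%:num * (h t)%:num].

Definition borel : measurableType _ := g_sigma_algebraType (@open E).

(* The measure mu_z^s; the normalizing sum is finite for s above the critical
   exponent, so fine loses nothing there. *)
Definition patterson_approx X (h : R -> {nonneg R}) (s : R) z (A : set borel)
    : \bar R :=
  \esum_(x in X `&` A)
    ((h (hdist x z))%:num * expR (- s * hdist x z) /
       fine (modified_poincare X h s 0))%:E.

Lemma patterson_weight_ge0 X h s z x :
  0 <= (h (hdist x z))%:num * expR (- s * hdist x z) /
         fine (modified_poincare X h s 0).
Proof.
apply: divr_ge0; first by rewrite mulr_ge0 ?expR_ge0.
apply/fine_ge0/esum_ge0 => y _.
by rewrite lee_fin mulr_ge0 ?expR_ge0.
Qed.

Section PattersonApproxMeasure.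
Variables (X : set E) (h : R -> {nonneg R}) (s : R) (z : E).
Local Notation mu := (patterson_approx X h s z).

Let mu0 : mu set0 = 0%E.
Proof. by rewrite /patterson_approx setI0 esum_set0. Qed.

Let mu_ge0 A : (0 <= mu A)%E.
Proof. by apply: esum_ge0 => x _; rewrite lee_fin patterson_weight_ge0. Qed.

Let mu_sigma_additive : semi_sigma_additive mu.
Proof.
move=> F mF tF mUF; rewrite /patterson_approx setI_bigcupr esum_bigcupT.
- rewrite -nneseries_esumT; last by move=> i; exact: mu_ge0.
  by apply: is_cvg_nneseries => i _ _; exact: mu_ge0.
- apply/trivIsetP => i j _ _ ij; rewrite setIACA.
  by move/trivIsetP: tF => -> //; rewrite setI0.
- by move=> x; rewrite lee_fin patterson_weight_ge0.
Qed.

HB.instance Definition _ := isMeasure.Build _ borel R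
  (patterson_approx X h s z) mu0 mu_ge0 mu_sigma_additive.

End PattersonApproxMeasure.

(* Measures on the closed ball are encoded as measures on the ambient space
   giving no mass to the complement; members indexed outside the open ball are
   unconstrained. *)
Definition patterson_measure X (mu : E -> {finite_measure set borel -> \bar R})
    : Prop :=
  exists (h : R -> {nonneg R}) (s : R^nat),
    [/\ patterson_function X h,
        [/\ forall j, critical_exponent X < s j, nonincreasing_seq s &
            s j @[j --> \oo] --> critical_exponent X] &
        forall z, hspace z ->
          mu z (~` cball) = 0%E /\
          forall f : E -> R, {within cball, continuous f} ->
            (\int[patterson_approx X h (s j) z]_(y in cball) (f y)%:E)%E
              @[j --> \oo] --> (\int[mu z]_(y in cball) (f y)%:E)%E].

(* xi is the end point of the geodesic ray from x passing through o. *)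
Definition opposite_end x (xi : E) : Prop :=
  exists g : R -> E,
    [/\ geodesic_on `[0, +oo[ g, g 0 = x, exists2 t, 0 <= t & g t = 0 &
        g t @[t --> +oo] --> xi].

Definition shadow x (l : R) : set E :=
  [set y | sphere y /\ exists2 xs, opposite_end x xs &
     geodesic_line xs y `&` hball x l !=set0].

Definition spherical_diam (S : set E) : R :=
  sup [set a | exists xi eta, [/\ S xi, S eta & a = acos (edot xi eta)]].

End HyperbolicSpace.

Arguments borel : clear implicits.

(* Main.v *)
Require Import Defs.
From HB Require Import structures.
From mathcomp Require Import all_boot all_order all_algebra.
From mathcomp Require Import all_classical all_reals all_analysis.
From mathcomp Require Import measurable_realfun ring lra.

(* Let S be the shadow, d its diameter and xi a point of S. If d >= 1, the mass
   bound is enough. If 0 < d <= 1, put z = (1 - d) xi: the Poisson kernel of z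
   is at least 1/d within distance d of xi, so d(mu_o)/d(mu_z) <= d^Delta on S,
   whence mu_o(S) <= K d^Delta. Thus |K| + 1 is a valid constant, and neither
   the size of S nor bounded type matters. The density inequality is extracted
   from the weak limits, testing them against a cut-off function which isolates
   the points near S where e^(d(x,z) - d(x,o)) is almost at most d.

   It remains to see that S is a Borel set. In the hyperboloid model, the
   geodesic line with end points xi, eta on the sphere is
   t |-> e^t a (1, eta) + e^(-t) b (1, xi) with 2ab(1 - xi.eta) = 1, so that
   the shadow is relatively open in the sphere. *)

Set Implicit Arguments.
Unset Strict Implicit.
Unset Printing Implicit Defensive.

Import Order.TTheory GRing.Theory Num.Theory.
Import numFieldNormedType.Exports.

Local Open Scope classical_set_scope.
Local Open Scope ring_scope.

(** * Euclidean inner product, open ball and sphere *)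

Section InnerProduct.
Context {R : realType} {n : nat}.
Local Notation E := 'rV[R]_n.+1.
Implicit Types (x y z : E) (a : R).

Lemma edotC x y : edot x y = edot y x.
Proof. by apply: eq_bigr => i _; rewrite mulrC. Qed.

Lemma edotDl x y z : edot (x + y) z = edot x z + edot y z.
Proof.
by rewrite /edot -big_split /=; apply: eq_bigr => i _; rewrite mxE mulrDl.
Qed.

Lemma edotDr x y z : edot z (x + y) = edot z x + edot z y.
Proof. by rewrite edotC edotDl !(edotC z). Qed.

Lemma edotZl a x y : edot (a *: x) y = a * edot x y.
Proof.
by rewrite /edot mulr_sumr; apply: eq_bigr => i _; rewrite mxE mulrA.
Qed.

Lemma edotZr a x y : edot x (a *: y) = a * edot x y.
Proof. by rewrite edotC edotZl edotC. Qed.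

Lemma edotNl x y : edot (- x) y = - edot x y.
Proof. by rewrite -scaleN1r edotZl mulN1r. Qed.

Lemma edotNr x y : edot x (- y) = - edot x y.
Proof. by rewrite edotC edotNl edotC. Qed.

Definition edotE := (edotDl, edotDr, edotNl, edotNr, edotZl, edotZr).

Lemma edot_ge0 x : 0 <= edot x x.
Proof. by apply: sumr_ge0 => i _; rewrite -expr2 sqr_ge0. Qed.

Lemma edot_eq0 x : edot x x = 0 -> x = 0.
Proof.
move=> /psumr_eq0P xx0; apply/rowP => i; rewrite mxE.
have /eqP : x ord0 i * x ord0 i = 0.
  by apply: xx0 => // j _; rewrite -expr2 sqr_ge0.
by rewrite mulf_eq0 orbb => /eqP.
Qed.

Lemma edot0l x : edot 0 x = 0.
Proof. by rewrite -(scale0r 0) edotZl mul0r. Qed.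

Lemma edot0r x : edot x 0 = 0.
Proof. by rewrite edotC edot0l. Qed.

Lemma edot_sub x y : edot (x - y) (x - y) = edot x x - 2 * edot x y + edot y y.
Proof. by rewrite !edotE (edotC y x); ring. Qed.

(** The squared norm of (y.y) x - (x.y) y is y.y times the difference of the two sides, so it
    suffices to divide by y.y when this is nonzero. *)
Lemma edot_CS x y : edot x y ^+ 2 <= edot x x * edot y y.
Proof.
have [y0|y0] := eqVneq (edot y y) 0.
  by rewrite (edot_eq0 y0) !edot0r expr0n mulr0.
have yy : 0 < edot y y by rewrite lt_neqAle eq_sym y0 edot_ge0.
have := edot_ge0 (edot y y *: x - edot x y *: y).
rewrite edot_sub !edotE => h.
rewrite -subr_ge0 -(pmulr_rge0 _ yy); apply: le_trans h _.
by rewrite le_eqVlt; apply/orP; left; apply/eqP; ring.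
Qed.

Lemma enorm_ge0 x : 0 <= enorm x.
Proof. exact: sqrtr_ge0. Qed.

Lemma enorm_sqr x : enorm x ^+ 2 = edot x x.
Proof. by rewrite sqr_sqrtr // edot_ge0. Qed.

Lemma hspaceE x : hspace x <-> edot x x < 1.
Proof.
by rewrite /hspace /= -enorm_sqr expr_lt1 ?enorm_ge0.
Qed.

Lemma sphereE x : sphere x <-> edot x x = 1.
Proof.
rewrite /sphere /= -enorm_sqr; split => [->|/eqP]; first by rewrite expr1n.
by rewrite sqrp_eq1 ?enorm_ge0 // => /eqP.
Qed.

Lemma cballE x : cball x <-> edot x x <= 1.
Proof.
rewrite le_eqVlt; split.
  by case=> [/hspaceE ->|/sphereE ->]; rewrite ?eqxx ?orbT.
by case/orP => [/eqP/sphereE|/hspaceE]; [right|left].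
Qed.

Lemma edot_le_enorm x y : edot x y <= enorm x * enorm y.
Proof.
have [xy0|xy0] := leP (edot x y) 0.
  by apply: le_trans xy0 _; rewrite mulr_ge0 ?enorm_ge0.
have h := edot_CS x y; rewrite -!enorm_sqr -exprMn in h.
by move: h; rewrite ler_pXn2r // nnegrE ?mulr_ge0 ?enorm_ge0 // ltW.
Qed.

Lemma edot_sphere x y : sphere x -> sphere y -> -1 <= edot x y <= 1.
Proof.
move=> /sphereE x1 /sphereE y1.
have := edot_CS x y; rewrite x1 y1 mulr1 => h.
by apply/andP; split; nra.
Qed.

Lemma continuous_edot (T : topologicalType) (f g : T -> E) :
  continuous f -> continuous g -> continuous (fun t => edot (f t) (g t)).
Proof.
move=> cf cg; rewrite /edot.
apply: continuous_big => [|i _ t]; first exact: add_continuous.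
apply: cvgM.
  exact: (continuous_comp (cf t) (@coord_continuous _ _ _ ord0 i (f t))).
exact: (continuous_comp (cg t) (@coord_continuous _ _ _ ord0 i (g t))).
Qed.

Lemma continuous_edotl x : continuous (edot x).
Proof.
by apply: (@continuous_edot _ (cst x) id); [exact: cst_continuous | move=> y A].
Qed.

Lemma continuous_edotr x : continuous (fun y => edot y x).
Proof.
by apply: (@continuous_edot _ id (cst x)); [move=> y A | exact: cst_continuous].
Qed.

Lemma continuous_sqnorm : continuous (fun y : E => edot y y).
Proof. by apply: (@continuous_edot _ id id) => y A. Qed.

End InnerProduct.

(** * Hyperbolic cosine and its inverse *)

Section HyperbolicCosine.
Context {R : realType}.
Implicit Types (r s c : R).

Definition cosh r := (expR r + expR (- r)) / 2.

Lemma coshN r : cosh (- r) = cosh r.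
Proof. by rewrite /cosh opprK addrC. Qed.

Lemma cosh_norm r : cosh `|r| = cosh r.
Proof. by have [_|_] := ger0P r; rewrite ?coshN. Qed.

Lemma cosh_ge1 r : 1 <= cosh r.
Proof.
rewrite /cosh expRN; have := expR_gt0 r; set e := expR r => e0.
have : 0 <= (e - 1) ^+ 2 / e by rewrite divr_ge0 ?sqr_ge0 ?ltW.
have -> : (e - 1) ^+ 2 / e = e + e^-1 - 2 by field; rewrite gt_eqF.
lra.
Qed.

Lemma arcoshK c : 1 <= c -> cosh (arcosh c) = c.
Proof.
move=> c1; rewrite /cosh /arcosh expRN.
have c20 : 0 <= c ^+ 2 - 1 by rewrite subr_ge0 exprn_ege1.
set q := Num.sqrt _.
have q2 : q ^+ 2 = c ^+ 2 - 1 by rewrite sqr_sqrtr.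
have q0 : 0 <= q by rewrite sqrtr_ge0.
rewrite lnK ?posrE; last lra.
have h : (c + q) * (c - q) = 1 by rewrite mulrC -subr_sqr q2; ring.
have cq : c + q != 0 by rewrite gt_eqF //; lra.
have -> : (c + q)^-1 = c - q by rewrite -[LHS]mulr1 -h mulKf.
by field.
Qed.

Lemma arcosh_ge0 c : 1 <= c -> 0 <= arcosh c.
Proof.
move=> c1; apply: ln_ge0; apply: le_trans c1 _.
by rewrite lerDl sqrtr_ge0.
Qed.

Lemma coshK r : 0 <= r -> arcosh (cosh r) = r.
Proof.
move=> r0; rewrite /arcosh.
have -> : cosh r ^+ 2 - 1 = ((expR r - expR (- r)) / 2) ^+ 2.
  rewrite /cosh expRN; field; rewrite gt_eqF ?expR_gt0 //.
rewrite sqrtr_sqr ger0_norm.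
  have -> : cosh r + (expR r - expR (- r)) / 2 = expR r by rewrite /cosh; field.
  exact: expRK.
by rewrite divr_ge0 // subr_ge0 ler_expR; lra.
Qed.

Lemma arcosh_le c c' : 1 <= c -> c <= c' -> arcosh c <= arcosh c'.
Proof.
move=> c1 cc'; rewrite /arcosh ler_ln ?posrE.
- rewrite lerD // ler_sqrt ?subr_ge0 ?exprn_ege1 //; last lra.
  by rewrite lerD2r ler_pXn2r ?nnegrE //; lra.
- by rewrite ltr_pwDl ?sqrtr_ge0 //; lra.
- by rewrite ltr_pwDl ?sqrtr_ge0 //; lra.
Qed.

Lemma arcosh_lt c r : 1 <= c -> 0 <= r -> (arcosh c < r) = (c < cosh r).
Proof.
move=> c1 r0; apply/idP/idP; apply: contraTT; rewrite -!leNgt => h.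
  by rewrite -(coshK r0) arcosh_le ?cosh_ge1.
rewrite -(arcoshK c1) /cosh !expRN.
have : expR r <= expR (arcosh c) by rewrite ler_expR.
have := expR_ge1Dx r; have := expR_gt0 r.
set e := expR r; set f := expR _ => e0 e1 ef.
have e1' : 1 <= e by lra.
have f0 : 0 < f by lra.
(* [cosh] increases on nonnegative reals: with e and f the two exponentials, the difference of the
   values factors through f - e and ef - 1, both nonnegative. *)
rewrite -subr_ge0.
have -> : (f + f^-1) / 2 - (e + e^-1) / 2 = (f - e) * (e * f - 1) / (2 * e * f).
  by field; rewrite !gt_eqF.
have e1f : 1 <= e * f by rewrite mulr_ege1 //; lra.
by rewrite divr_ge0 // !mulr_ge0 ?subr_ge0 // ltW.
Qed.

(** For d = arcosh c, e^d = 2c - e^(-d) with 0 < e^(-d) <= 1. This bound and the next one replace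
    e^d by rational expressions in the coordinates. *)
Lemma expR_arcosh_le c : 1 <= c -> expR (arcosh c) <= 2 * c.
Proof.
move=> c1; have := arcoshK c1; rewrite /cosh => h.
have := expR_gt0 (- arcosh c); lra.
Qed.

Lemma expR_arcosh_ge c : 1 <= c -> 2 * c - 1 <= expR (arcosh c).
Proof.
move=> c1; have := arcoshK c1; rewrite /cosh => h.
have : expR (- arcosh c) <= 1 by rewrite -expR0 ler_expR oppr_le0 arcosh_ge0.
lra.
Qed.

End HyperbolicCosine.

(** * The hyperboloid model of hyperbolic space *)

Section Hyperboloid.
Context {R : realType} {n : nat}.
Local Notation E := 'rV[R]_n.+1.
Implicit Types (x y z w : E) (g : R -> E).

(* Time and space components of the image of a point of the ball in the
   hyperboloid model. *)
Definition tpart x : R := (1 + edot x x) / (1 - edot x x).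
Definition spart x : E := (2 / (1 - edot x x)) *: x.

Definition hcosh x y : R :=
  1 + 2 * edot (x - y) (x - y) / ((1 - edot x x) * (1 - edot y y)).

Lemma hdistE x y : hdist x y = arcosh (hcosh x y).
Proof. by rewrite /hdist !enorm_sqr. Qed.

Lemma hcosh_ge1 x y : hspace x -> hspace y -> 1 <= hcosh x y.
Proof.
move=> /hspaceE x1 /hspaceE y1; rewrite lerDl.
by rewrite divr_ge0 ?mulr_ge0 ?edot_ge0 // subr_ge0 ltW.
Qed.

(** The right side is, up to sign, the Minkowski product of the lifts of x and y. *)
Lemma hcoshE x y : hspace x -> hspace y ->
  hcosh x y = tpart x * tpart y - edot (spart x) (spart y).
Proof.
move=> /hspaceE x1 /hspaceE y1.
rewrite /hcosh /tpart /spart edot_sub !edotE; field.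
by apply/andP; split; rewrite gt_eqF // subr_gt0.
Qed.

Lemma tpart_sqr x : hspace x -> tpart x ^+ 2 = 1 + edot (spart x) (spart x).
Proof.
move=> hx; have := hcoshE hx hx.
rewrite /hcosh subrr edot0l mulr0 mul0r addr0 expr2 => ->; ring.
Qed.

Lemma tpart_ge1 x : hspace x -> 1 <= tpart x.
Proof.
move=> /hspaceE x1; rewrite /tpart ler_pdivlMr ?subr_gt0 //.
have := edot_ge0 x; lra.
Qed.

Lemma spartK x : hspace x -> (1 + tpart x)^-1 *: spart x = x.
Proof.
move=> /hspaceE x1; rewrite /tpart /spart scalerA -[RHS]scale1r; congr (_ *: _).
field; apply/andP; split; first by rewrite gt_eqF // subr_gt0.
by rewrite gt_eqF //; lra.
Qed.

(** Stereographic projection of the upper sheet inverts the lift; here w.w = (T - 1) / (T + 1). *)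
Lemma hyperboloid_ball (T : R) (Z : E) : 0 < T -> T ^+ 2 = 1 + edot Z Z ->
  let w := (1 + T)^-1 *: Z in [/\ hspace w, tpart w = T & spart w = Z].
Proof.
move=> T0 TZ w.
have ww : edot w w = (T - 1) / (T + 1).
  rewrite !edotE (_ : edot Z Z = T ^+ 2 - 1); last by rewrite TZ; ring.
  by field; rewrite gt_eqF //; lra.
have w1 : 1 - edot w w = 2 / (T + 1).
  by rewrite ww; field; rewrite gt_eqF //; lra.
split.
- by apply/hspaceE; rewrite -subr_gt0 w1 divr_gt0 //; lra.
- by rewrite /tpart w1 ww; field; rewrite gt_eqF //; lra.
- rewrite /spart w1 scalerA -[RHS]scale1r; congr (_ *: _).
  by field; rewrite gt_eqF //; lra.
Qed.

(* In Minkowski space, a light-like vector orthogonal to a time-like vector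
   vanishes. *)
Lemma lightlike_orth (w0 T : R) (w Z : E) :
  w0 ^+ 2 = edot w w -> w0 * T = edot w Z -> T ^+ 2 = 1 + edot Z Z ->
  w0 = 0 /\ w = 0.
Proof.
move=> h1 h2 h3.
have w00 : w0 = 0.
  apply/eqP; rewrite -sqrf_eq0; apply/eqP.
  have := edot_CS w Z; rewrite -h2 exprMn -h1 h3 => h.
  have := sqr_ge0 w0; nra.
by split=> //; apply: edot_eq0; rewrite -h1 w00 expr0n.
Qed.

(** * Geodesic lines in Minkowski coordinates *)

Lemma geodesic_cosh g s t : geodesic_on setT g -> 
  edot (spart (g s)) (spart (g t)) = tpart (g s) * tpart (g t) - cosh (s - t).
Proof.
move=> [hg dg]; rewrite -cosh_norm -dg // hdistE arcoshK ?hcosh_ge1 //; try exact: hg.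
rewrite hcoshE; [ring | exact: hg | exact: hg].
Qed.

(** The products determine the curve from its points at times 0 and 1: the point at time t, minus
    their combination with coefficients sinh(1 - t) / sinh 1 and sinh t / sinh 1, is light-like and
    orthogonal to the point at time 0, hence zero. *)
Lemma hyperboloid_geodesic (T : R -> R) (Z : R -> E) :
  (forall s t, edot (Z s) (Z t) = T s * T t - cosh (s - t)) ->
  exists a b A B, [/\ a ^+ 2 = edot A A, b ^+ 2 = edot B B,
    2 * (a * b - edot A B) = 1 &
    forall t, T t = expR t * a + expR (- t) * b /\
              Z t = expR t *: A + expR (- t) *: B].
Proof.
move=> gc.
set e := expR 1 : R.
have e0 : 0 < e by exact: expR_gt0.
have e1 : 1 < e by rewrite /e expR_gt1.
have s0 : e ^+ 2 - 1 != 0 by rewrite gt_eqF // subr_gt0 expr_gt1 ?ltW.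
have en0 : e != 0 by rewrite gt_eqF.
pose s1 := e - e^-1.
have cosh1 : cosh 1 = (e + e^-1) / 2 by rewrite /cosh expRN.
have cosh0 : cosh 0 = 1 :> R by rewrite /cosh oppr0 expR0; field.
have g00 := gc 0 0; have g01 := gc 0 1; have g11 := gc 1 1.
rewrite sub0r coshN cosh1 in g01.
rewrite subrr cosh0 in g00; rewrite subrr cosh0 in g11.
(* These four witnesses solve the claimed formula at t = 0 and t = 1. *)
exists ((T 1 - e^-1 * T 0) / s1).
exists ((e * T 0 - T 1) / s1).
exists (s1^-1 *: (Z 1 - e^-1 *: Z 0)).
exists (s1^-1 *: (e *: Z 0 - Z 1)).
rewrite !edotE (edotC (Z 1) (Z 0)) g00 g01 g11; split.
- by rewrite /s1; field; rewrite en0 s0.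
- by rewrite /s1; field; rewrite en0 s0.
- by rewrite /s1; field; rewrite en0 s0.
move=> t.
have gtt := gc t t; rewrite subrr cosh0 in gtt.
have g0t := gc 0 t; rewrite sub0r coshN in g0t.
have gt1 := gc 1 t.
set u := expR t; have u0 : 0 < u by exact: expR_gt0.
have un0 : u != 0 by rewrite gt_eqF.
have cosht : cosh t = (u + u^-1) / 2 by rewrite /cosh expRN.
have cosh1t : cosh (1 - t) = (e / u + u / e) / 2.
  rewrite /cosh opprB !expRD !expRN //.
rewrite cosht in g0t; rewrite cosh1t in gt1; rewrite expRN -/u.
pose al := (e / u - u / e) / s1; pose be := (u - u^-1) / s1.
pose w0 := T t - al * T 0 - be * T 1.
pose w := Z t - al *: Z 0 - be *: Z 1.
have [] := @lightlike_orth w0 (T 0) w (Z 0).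
- rewrite /w !edotE (edotC (Z 1) (Z 0)).
  rewrite (edotC (Z t) (Z 0)) (edotC (Z t) (Z 1)).
  rewrite g00 g01 g11 g0t gt1 gtt /w0 /al /be /s1.
  by field; rewrite en0 s0 un0.
- rewrite /w !edotE (edotC (Z 1) (Z 0)).
  rewrite (edotC (Z t) (Z 0)).
  rewrite g00 g01 g0t /w0 /al /be /s1.
  by field; rewrite en0 s0 un0.
- by rewrite g00; ring.
rewrite /w0 /w => h1 h2; split.
  have -> : T t = al * T 0 + be * T 1.
    by apply/eqP; rewrite -subr_eq0 opprD addrA h1.
  by rewrite /al /be /s1; field; rewrite en0 s0 un0.
have -> : Z t = al *: Z 0 + be *: Z 1.
  by apply/eqP; rewrite -subr_eq0 opprD addrA h2.
apply/rowP => i; rewrite !mxE /al /be /s1.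
by field; rewrite en0 s0 un0.
Qed.

(** In g = [spart] / (1 + [tpart]), divide numerator and denominator by e^t; the remaining
    exponentials e^(-t) and e^(-2t) vanish in the limit. *)
Lemma lift_cvg g a b (A B : E) : 0 < a ->
  (forall t, hspace (g t)) ->
  (forall t, tpart (g t) = expR t * a + expR (- t) * b) ->
  (forall t, spart (g t) = expR t *: A + expR (- t) *: B) ->
  g t @[t --> +oo] --> a^-1 *: A.
Proof.
move=> a0 hg gT gS.
have -> : g = fun t => (expR (- t) + a + expR (- t) * expR (- t) * b)^-1 *:
                      (A + (expR (- t) * expR (- t)) *: B).
  apply/funext => t; rewrite -[LHS]spartK ?gT ?gS //.
  have := tpart_ge1 (hg t); rewrite gT expRN; have := expR_gt0 t.
  set u := expR t => u0 T1.
  set d := u^-1 + a + _.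
  have ud : 1 + (u * a + u^-1 * b) = u * d.
    by rewrite /d; field; rewrite gt_eqF.
  have d0 : d != 0.
    by rewrite -(mulrI_eq0 _ (mulfI (lt0r_neq0 u0))) -ud gt_eqF //; lra.
  apply/rowP => i; rewrite !mxE ud.
  by field; rewrite d0 gt_eqF.
have ce : expR (- t) @[t --> +oo] --> (0 : R) := @cvgr_expR R.
have cee : expR (- t) * expR (- t) @[t --> +oo] --> (0 : R).
  by rewrite -[0](mulr0 0); apply: cvgM.
have -> : a^-1 *: A = (0 + a + 0 * b)^-1 *: (A + 0 *: B).
  by rewrite mul0r scale0r !addr0 add0r.
apply: cvgZ.
  apply: cvgV; first by rewrite mul0r addr0 add0r gt_eqF.
  apply: cvgD; last by apply: cvgM => //; exact: cvg_cst.
  by apply: cvgD => //; exact: cvg_cst.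
by apply: cvgD; [exact: cvg_cst | apply: cvgZ => //; exact: cvg_cst].
Qed.

(** The light-like coefficients of the lift are multiples of (1, eta) and (1, xi), because their
    directions are the limits of g and of its time reversal. *)
Lemma geodesic_line_lift g xi eta : geodesic_on setT g ->
  g t @[t --> -oo] --> xi -> g t @[t --> +oo] --> eta ->
  [/\ sphere xi, sphere eta & exists a b, [/\ 0 < a, 0 < b,
    2 * (a * b) * (1 - edot eta xi) = 1 &
    forall t, tpart (g t) = expR t * a + expR (- t) * b /\
      spart (g t) = (expR t * a) *: eta + (expR (- t) * b) *: xi]].
Proof.
move=> hg gxi geta; have hg0 t : hspace (g t) by exact: hg.1.
have [|a [b [A [B [aA bB abAB gl]]]]] :=
  @hyperboloid_geodesic (fun t => tpart (g t)) (fun t => spart (g t)).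
  by move=> s t; exact: geodesic_cosh.
(* Cauchy-Schwarz gives (ab - 1/2)^2 <= (ab)^2, so ab >= 1/4; the common sign of a and b is then
   that of a + b, the time component at t = 0. *)
have ab0 : 0 < a * b.
  have := edot_CS A B; rewrite -aA -bB -exprMn => h.
  have ABE : edot A B = a * b - 2^-1 by lra.
  rewrite ABE in h; nra.
have abT : 0 < a + b.
  have := tpart_ge1 (hg0 0); rewrite (gl 0).1 oppr0 expR0; lra.
have a0 : 0 < a by nra.
have b0 : 0 < b by nra.
have etaE : eta = a^-1 *: A.
  apply: (cvg_unique (@norm_hausdorff _ E) geta).
  by apply: (@lift_cvg g a b A B) => // t; have [] := gl t.
have xiE : xi = b^-1 *: B.
  have gxi' : g (- t) @[t --> +oo] --> xi by exact/cvgNy_compNP.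
  apply: (cvg_unique (@norm_hausdorff _ E) gxi').
  apply: (@lift_cvg (g \o -%R) b a B A) => //= t.
    by rewrite (gl (- t)).1 opprK addrC.
  by rewrite (gl (- t)).2 opprK addrC.
have AE : A = a *: eta by rewrite etaE scalerA divff ?scale1r // gt_eqF.
have BE : B = b *: xi by rewrite xiE scalerA divff ?scale1r // gt_eqF.
split.
- apply/sphereE; rewrite xiE !edotE -bB; field; by rewrite gt_eqF.
- apply/sphereE; rewrite etaE !edotE -aA; field; by rewrite gt_eqF.
exists a, b; split => //.
  by rewrite -[RHS]abAB AE BE !edotE; ring.
by move=> t; have [-> ->] := gl t; rewrite AE BE !scalerA.
Qed.

(** The normalization of ab makes the Minkowski products of the curve equal to -cosh(s - t). It
    therefore stays on the hyperboloid and has unit speed there, and its projection to the ball is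
    the geodesic. *)
Lemma geodesic_line_exists a b xi eta : sphere xi -> sphere eta ->
  0 < a -> 0 < b -> 2 * (a * b) * (1 - edot eta xi) = 1 ->
  exists g, [/\ geodesic_on setT g, g t @[t --> -oo] --> xi,
    g t @[t --> +oo] --> eta &
    forall t, tpart (g t) = expR t * a + expR (- t) * b /\
      spart (g t) = (expR t * a) *: eta + (expR (- t) * b) *: xi].
Proof.
move=> /sphereE xi1 /sphereE eta1 a0 b0 hab.
pose T t := expR t * a + expR (- t) * b.
pose Z t := (expR t * a) *: eta + (expR (- t) * b) *: xi.
have ZZ s t : edot (Z s) (Z t) = T s * T t - cosh (s - t).
  rewrite /Z /T !edotE xi1 eta1 (edotC xi eta) /cosh opprB !expRD !expRN.
  have -> : edot eta xi = 1 - (2 * (a * b))^-1.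
    have h2 : 2 * (a * b) != 0 by rewrite gt_eqF ?mulr_gt0.
    by rewrite -[_^-1]mulr1 -[X in _ * X]hab mulKf //; ring.
  by field; rewrite !gt_eqF ?expR_gt0.
have T0 t : 0 < T t by rewrite addr_gt0 // mulr_gt0 ?expR_gt0.
have TZ t : T t ^+ 2 = 1 + edot (Z t) (Z t).
  by rewrite ZZ subrr /cosh oppr0 expR0; field.
pose g t := (1 + T t)^-1 *: Z t.
have hg t : [/\ hspace (g t), tpart (g t) = T t & spart (g t) = Z t].
  exact: hyperboloid_ball.
have etaE : eta = a^-1 *: (a *: eta).
  by rewrite scalerA mulVf ?scale1r // gt_eqF.
have xiE : xi = b^-1 *: (b *: xi).
  by rewrite scalerA mulVf ?scale1r // gt_eqF.
exists g; split; last by move=> t; have [_ -> ->] := hg t.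
- split => [t _|s t _ _]; first by have [] := hg t.
  have [hs Ts Zs] := hg s; have [ht Tt Zt] := hg t.
  rewrite hdistE hcoshE // Ts Tt Zs Zt ZZ.
  by rewrite -(@coshK _ `|s - t|) // cosh_norm; congr arcosh; ring.
- apply/cvgNy_compNP.
  suff : (g \o -%R) t @[t --> +oo] --> b^-1 *: (b *: xi) by rewrite -xiE.
  apply: (@lift_cvg (g \o -%R) b a _ (a *: eta)) => //= t.
  + by have [] := hg (- t).
  + by have [_ -> _] := hg (- t); rewrite /T opprK addrC.
  + by have [_ _ ->] := hg (- t); rewrite /Z opprK addrC !scalerA.
- suff : g t @[t --> +oo] --> a^-1 *: (a *: eta) by rewrite -etaE.
  apply: (@lift_cvg g a b _ (b *: xi)) => // t.
  + by have [] := hg t.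
  + by have [_ -> _] := hg t.
  + by have [_ _ ->] := hg t; rewrite /Z !scalerA.
Qed.

(** * Convex hulls and shadows *)

Lemma hull_hspace (L : set E) : hull L `<=` hspace.
Proof.
move=> x; apply; first by split => // a g a0 [hg _] _ _ t ta; exact: hg.
by move=> xi eta _ _ y [g [[hg _] _ _ [t ->]]]; exact: hg.
Qed.

(** Up to sign, the Minkowski product of the lift of x with (1, y), which is light-like for y on the
    sphere. *)
Let p x y := tpart x - edot (spart x) y.

(* Up to a time shift, the geodesic line from xi to y lifts to
   e^t (1, y) + e^(-t) (1, xi) / (2 (1 - y.xi)); the defining inequality says
   that its point at time t lies in the ball of centre x and radius l. *)
Let near_shadow x (l : R) xi (t : R) : set E :=
  [set y | 0 < cosh l * (2 * (1 - edot y xi)) -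
               (expR t * p x y * (2 * (1 - edot y xi)) + expR (- t) * p x xi)].

Lemma near_shadow_open x l xi t : open (near_shadow x l xi t).
Proof.
have -> : near_shadow x l xi t =
  (fun y => cosh l * (2 * (1 - edot y xi)) -
    (expR t * p x y * (2 * (1 - edot y xi)) + expR (- t) * p x xi)) @^-1`
  [set r | 0 < r] by [].
apply: open_comp; last exact: open_gt.
have cont (T : topologicalType) (f1 f2 : T -> R) (c u k q : R) :
    continuous f1 -> continuous f2 ->
    continuous (fun r => c * (2 * (1 - f1 r)) -
                         (u * (k - f2 r) * (2 * (1 - f1 r)) + q)).
  move=> c1 c2 r.
  have c3 : (2 * (1 - f1 r')) @[r' --> r] --> 2 * (1 - f1 r).
    apply: cvgM; first exact: cvg_cst.
    by apply: cvgB; [exact: cvg_cst | exact: c1].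
  apply: cvgB; first by apply: cvgM => //; exact: cvg_cst.
  apply: cvgD; last exact: cvg_cst.
  apply: cvgM => //; apply: cvgM; first exact: cvg_cst.
  by apply: cvgB; [exact: cvg_cst | exact: c2].
move=> y _.
exact: (cont _ _ _ _ _ _ _ (@continuous_edotr R n xi)
  (@continuous_edotl R n (spart x))).
Qed.

Lemma p_gt0 x y : hspace x -> sphere y -> 0 < p x y.
Proof.
move=> hx /sphereE y1; rewrite subr_gt0.
have := edot_CS (spart x) y; rewrite y1 mulr1 => h.
have := tpart_sqr hx; have := tpart_ge1 hx; nra.
Qed.

Lemma hcosh_line x y xi (w : E) a b : hspace x -> hspace w ->
  tpart w = a + b -> spart w = a *: y + b *: xi ->
  hcosh x w = a * p x y + b * p x xi.
Proof. by move=> hx hw T S; rewrite hcoshE // T S edotDr !edotZr /p; ring. Qed.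

Lemma shadowE x (l : R) : hspace x -> 0 < l ->
  shadow x l = sphere `&`
    \bigcup_(xi in [set xi | sphere xi /\ opposite_end x xi])
      \bigcup_t near_shadow x l xi t.
Proof.
move=> hx l0; apply/seteqP; split=> [y [sy [xi oxi]]|y [sy [xi [sxi oxi] [t _]]]].
  move=> [_ [[g [hg gxi gy [t ->]]] [hgt]]].
  rewrite hdistE arcosh_lt ?hcosh_ge1 ?ltW // => hl.
  have [sxi _ [a [b [a0 b0 hab gl]]]] := geodesic_line_lift hg gxi gy.
  (* The shift by ln a normalizes the coefficient of (1, y) to an exponential; that of (1, xi)
     follows from 2ab(1 - y.xi) = 1. *)
  split=> //; exists xi => //; exists (t + ln a) => //=.
  have [Tt St] := gl t.
  move: hl; rewrite (hcosh_line hx hgt Tt St).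
  rewrite /near_shadow /= (opprD t) !expRD (expRN (ln a)) lnK ?posrE // => hl.
  have k0 : 0 < 1 - edot y xi.
    have ab0 : 0 < 2 * (a * b) by rewrite !mulr_gt0.
    by rewrite -(pmulr_rgt0 _ ab0) hab.
  rewrite (_ : a^-1 = b * (2 * (1 - edot y xi))); last first.
    have an0 : a != 0 by rewrite gt_eqF.
    by apply: (mulfI an0); rewrite mulfV // -[LHS]hab; ring.
  rewrite (_ : _ - _ = 2 * (1 - edot y xi) * (cosh l -
    (expR t * a * p x y + expR (- t) * b * p x xi))); last ring.
  by rewrite !mulr_gt0 // subr_gt0.
rewrite /near_shadow /= => h.
have e0 := expR_gt0 t; have en0 := expR_gt0 (- t).
have px := p_gt0 hx sxi; have py := p_gt0 hx sy.
(* If y.xi were 1, the inequality would read 0 < -e^(-t) p(x, xi), against the positivity of p. *)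
have k0 : 0 < 1 - edot y xi.
  have /andP[_] := edot_sphere sy sxi; rewrite -subr_ge0 le_eqVlt.
  case/orP => // /eqP k0; move: h; rewrite -k0 !mulr0 !add0r.
  by rewrite oppr_gt0 ltNge mulr_ge0 ?ltW.
have k1 : 0 < (2 * (1 - edot y xi))^-1 by rewrite invr_gt0 mulr_gt0.
have [|g [hg gxi gy gl]] := geodesic_line_exists sxi sy ltr01 k1.
  by field; rewrite gt_eqF.
split=> //; exists xi => //; exists (g t); split.
  by exists g; split => //; exists t.
have [Tt St] := gl t.
have hgt : hspace (g t) by exact: hg.1.
split=> //; rewrite hdistE arcosh_lt ?hcosh_ge1 ?ltW //.
rewrite (hcosh_line hx hgt Tt St) mulr1 -subr_gt0.
have k2 : 0 < 2 * (1 - edot y xi) by rewrite mulr_gt0.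
rewrite -(pmulr_rgt0 _ k2); apply: lt_le_trans h _.
rewrite le_eqVlt; apply/orP; left; apply/eqP.
by field; rewrite gt_eqF.
Qed.

Lemma shadow_open x (l : R) : hspace x -> 0 < l ->
  exists2 U, open U & shadow x l = sphere `&` U.
Proof.
move=> hx l0; eexists; last exact: shadowE.
by apply: bigcup_open => xi _; apply: bigcup_open => t _; exact: near_shadow_open.
Qed.

End Hyperboloid.

(** * Comparison of the distances to z and to the origin near the sphere *)

Section DistanceEstimates.
Context {R : realType} {n : nat}.
Local Notation E := 'rV[R]_n.+1.
Implicit Types (x y z : E).

(* A continuous function on the closed ball which bounds e^(d(x,z) - d(x,o))
   in the ball and is the inverse Poisson kernel on the sphere. *)
Definition inv_poisson z x : R :=
  (2 * (1 - edot x x) + 4 * edot (x - z) (x - z) / (1 - edot z z)) /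
  (1 + 3 * edot x x).

Lemma inv_poisson_sphere z x : sphere x ->
  inv_poisson z x = edot (x - z) (x - z) / (1 - edot z z).
Proof.
by move=> /sphereE x1; rewrite /inv_poisson x1; set i := (1 - edot z z)^-1; field.
Qed.

Lemma continuous_inv_poisson z : continuous (inv_poisson z).
Proof.
have cont (T : topologicalType) (f1 f2 : T -> R) (c : R) :
    continuous f1 -> continuous f2 -> (forall r, 0 <= f1 r) ->
    continuous (fun r => (2 * (1 - f1 r) + 4 * f2 r / c) / (1 + 3 * f1 r)).
  move=> c1 c2 f10 r.
  have cM k (f : T -> R) : continuous f -> k * f r' @[r' --> r] --> k * f r.
    by move=> cf; apply: cvgM; [exact: cvg_cst | exact: cf].
  apply: cvgM.
    apply: cvgD; last by apply: cvgM; [exact: cM | exact: cvg_cst].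
    by apply: (cM 2 (fun r => 1 - f1 r)) => r'; apply: cvgB;
      [exact: cvg_cst | exact: c1].
  apply: cvgV; first by have := f10 r => ?; rewrite gt_eqF //; lra.
  by apply: cvgD; [exact: cvg_cst | exact: cM].
have cs : continuous (fun y => y - z).
  by move=> y; exact: (cvgB (@cvg_id _ (nbhs y)) (@cvg_cst _ z _ (nbhs y) _)).
exact: (cont _ _ _ _ continuous_sqnorm (continuous_edot cs cs) (@edot_ge0 R n)).
Qed.

(** Needed since a Patterson function is monotone on positive arguments only. *)
Lemma hdist_origin_gt0 x : hspace x -> 0 < edot x x -> 0 < hdist x 0.
Proof.
move=> hx x0; have /hspaceE x1 := hx.
have h0 : hspace (0 : E) by apply/hspaceE; rewrite edot0l.
have := expR_arcosh_ge (hcosh_ge1 hx h0); rewrite -hdistE.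
rewrite /hcosh subr0 edot0l subr0 mulr1 => h.
rewrite -expR_gt1; apply: lt_le_trans h.
rewrite -subr_gt0 (_ : _ - 1 = 4 * edot x x / (1 - edot x x)).
  by rewrite divr_gt0 ?mulr_gt0 // subr_gt0.
by ring.
Qed.

(** Bound e^d(x,z) above by 2 cosh d(x,z) and e^d(x,o) below by 2 cosh d(x,o) - 1; the quotient of
    these bounds is exactly [inv_poisson]. *)
Lemma expR_hdist_sub_le x z : hspace x -> hspace z ->
  expR (hdist x z - hdist x 0) <= inv_poisson z x.
Proof.
move=> hx hz; have /hspaceE x1 := hx; have /hspaceE z1 := hz.
have h0 : hspace (0 : E) by apply/hspaceE; rewrite edot0l.
have := expR_arcosh_le (hcosh_ge1 hx hz); rewrite -hdistE => hxz.
have := expR_arcosh_ge (hcosh_ge1 hx h0); rewrite -hdistE.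
rewrite {1}/hcosh subr0 edot0l subr0 mulr1 => hx0.
rewrite expRD expRN ler_pdivrMr ?expR_gt0 //.
apply: (le_trans hxz).
have x10 : 1 - edot x x != 0 by rewrite gt_eqF // subr_gt0.
have z10 : 1 - edot z z != 0 by rewrite gt_eqF // subr_gt0.
have x30 : 0 < 1 + 3 * edot x x by have := edot_ge0 x; lra.
rewrite (_ : 2 * hcosh x z = inv_poisson z x * (2 * (1 + 2 * edot x x / (1 - edot x x)) - 1)).
  apply: ler_wpM2l => //; rewrite /inv_poisson.
  apply: divr_ge0; last exact: ltW.
  apply: addr_ge0; first by rewrite mulr_ge0 // subr_ge0 ltW.
  by rewrite divr_ge0 ?mulr_ge0 ?edot_ge0 // subr_ge0 ltW.
rewrite /hcosh /inv_poisson; field.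
by rewrite x10 z10 gt_eqF.
Qed.

(* The constant t plays the role of d(z, o). *)
Lemma hdist_near_boundary z : hspace z -> exists2 t : R, 0 < t &
  forall r0 : R, exists2 de : R, 0 < de &
    forall x, hspace x -> 1 - edot x x < de ->
      [/\ r0 <= hdist x z, hdist x 0 <= hdist x z + t & 0 < hdist x 0].
Proof.
move=> hz; have ze : enorm z < 1 := hz; have z0 := enorm_ge0 z.
have /hspaceE z1 := hz.
set ze' := enorm z in ze z0 *.
have [m0 m0E] : {m | m = ((1 - ze') / 2) ^+ 2} by exists (((1 - ze') / 2) ^+ 2).
have m00 : 0 < m0 by rewrite m0E exprn_gt0 // divr_gt0 // subr_gt0.
have m01 : m0 < 1.
  by rewrite m0E expr_lt1 ?divr_ge0 ?subr_ge0 ?ltW //; lra.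
(* Here [m0] bounds |x - z|^2 below once |x| > (1 + |z|) / 2. Then e^d(x,z) >= 2 m0 / (1 - |x|^2),
   while e^d(x,o) <= 4 / (1 - |x|^2); the ratio is 2 / m0. *)
exists (ln (2 / m0)).
  by rewrite ln_gt0 // ltr_pdivlMr //; lra.
move=> r0.
(* The first term forces |x| > (1 + |z|) / 2, the second d(x,z) >= r0. *)
exists (Num.min (1 - ((1 + ze') / 2) ^+ 2) (2 * m0 * expR (- r0))).
  rewrite lt_min; apply/andP; split; last by rewrite !mulr_gt0 ?expR_gt0.
  by rewrite subr_gt0 expr_lt1 //; lra.
move=> x hx; rewrite lt_min => /andP[xd1 xd2].
have /hspaceE x1 := hx; have x0 := enorm_ge0 x.
have h0 : hspace (0 : E) by apply/hspaceE; rewrite edot0l.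
have rx : (1 + ze') / 2 < enorm x.
  rewrite -(@ltr_pXn2r _ 2) ?nnegrE //; last lra.
  by rewrite enorm_sqr; lra.
have xz : m0 <= edot (x - z) (x - z).
  rewrite edot_sub -!enorm_sqr -/ze'.
  have := edot_le_enorm x z; rewrite -/ze' => h.
  apply: (@le_trans _ _ ((enorm x - ze') ^+ 2)).
    by rewrite m0E ler_pXn2r ?nnegrE //; lra.
  by rewrite sqrrB; lra.
have dx0 : 0 < 1 - edot x x by rewrite subr_gt0.
have dz0 : 0 < 1 - edot z z by rewrite subr_gt0.
have ez : 2 * m0 / (1 - edot x x) <= expR (hdist x z).
  have := expR_arcosh_ge (hcosh_ge1 hx hz); rewrite -hdistE.
  apply: le_trans; rewrite /hcosh.
  apply: (@le_trans _ _ (2 * edot (x - z) (x - z) / ((1 - edot x x) * (1 - edot z z)))).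
    rewrite ler_pdivlMr ?mulr_gt0 //.
    rewrite [leLHS](_ : _ = 2 * (m0 * (1 - edot z z))); last first.
      by field; rewrite gt_eqF.
    rewrite ler_wpM2l //; apply: le_trans xz; rewrite -[leRHS]mulr1.
    by rewrite ler_wpM2l ?(ltW m00) // gerBl edot_ge0.
  set q := _ / _; have : 0 <= q by rewrite /q divr_ge0 ?mulr_ge0 ?edot_ge0 ?ltW.
  lra.
split.
- rewrite -ler_expR; apply: le_trans ez.
  rewrite ler_pdivlMr // mulrC -ler_pdivlMr ?expR_gt0 // -expRN ltW //.
- rewrite -ler_expR expRD lnK ?posrE ?divr_gt0 //.
  have := expR_arcosh_le (hcosh_ge1 hx h0); rewrite -hdistE.
  move/le_trans; apply.
  apply: (@le_trans _ _ (2 * m0 / (1 - edot x x) * (2 / m0))); last first.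
    by rewrite ler_wpM2r // divr_ge0 ?ltW.
  rewrite /hcosh subr0 edot0l subr0 mulr1 -subr_ge0.
  rewrite [X in 0 <= X](_ : _ = 2); first by [].
  by field; rewrite !gt_eqF.
- apply: hdist_origin_gt0 => //.
  rewrite -enorm_sqr exprn_gt0 //; lra.
Qed.

End DistanceEstimates.

(** * Density of the Patterson measure at o with respect to the one at z *)

Section PattersonDensity.
Context {R : realType} {n : nat}.
Local Notation E := 'rV[R]_n.+1.
Implicit Types (x y z : E) (C X : set E) (h : R -> {nonneg R}).

(** Near the sphere d(x,o) <= d(x,z) + t, so the slow growth of h costs a factor e^(eps t); the
    exponentials cost (b e^eps)^s. *)
Lemma patterson_weight_le X h z : patterson_function X h -> hspace z ->
  exists2 t : R, 0 < t & forall eps b : R, 0 < eps -> 0 < b ->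
    exists2 de : R, 0 < de & forall x s, hspace x -> 0 <= s ->
      1 - edot x x < de -> inv_poisson z x < b + de ->
      (h (hdist x 0))%:num * expR (- s * hdist x 0) <=
      expR (eps * (t + s) + s * ln b) *
        ((h (hdist x z))%:num * expR (- s * hdist x z)).
Proof.
move=> [[_ _ _ hmono] _ hsub _] hz.
have [t t0 near_bd] := hdist_near_boundary hz; exists t => // eps b eps0 b0.
have [r0 r00 hr0] := hsub eps eps0.
have [d1 d10 hd1] := near_bd r0.
have be0 : 0 < b * (expR eps - 1) by rewrite mulr_gt0 // subr_gt0 expR_gt1.
(* The second term ensures b + de <= b e^eps. *)
exists (Num.min d1 (b * (expR eps - 1))); first by rewrite lt_min d10.
move=> x s hx s0; rewrite lt_min => /andP[xd _] xb.
have [r0z x0z x0] := hd1 x hx xd.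
have hle : (h (hdist x 0))%:num <= expR (eps * t) * (h (hdist x z))%:num.
  apply: (@le_trans _ _ (h (t + hdist x z))%:num); last exact: hr0.
  by apply: hmono => //; rewrite addrC.
have dle : hdist x z - hdist x 0 <= ln b + eps.
  rewrite -ler_expR (expRD (ln b)) lnK ?posrE //.
  apply: le_trans (expR_hdist_sub_le hx hz) _; apply: le_trans (ltW xb) _.
  rewrite (_ : b * expR eps = b + b * (expR eps - 1)); last ring.
  by rewrite lerD2l ge_min lexx orbT.
have ele : expR (- s * hdist x 0) <=
    expR (eps * s + s * ln b) * expR (- s * hdist x z).
  by rewrite -expRD ler_expR; nra.
apply: (le_trans (ler_pM _ _ hle ele)); rewrite ?expR_ge0 //.
rewrite mulrACA -expRD le_eqVlt; apply/orP; left; apply/eqP.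
by congr (expR _ * _); ring.
Qed.

Lemma open_borel (U : set E) : open U -> measurable (U : set (borel R n)).
Proof. by move=> oU; exact: sub_sigma_algebra. Qed.

Lemma closed_borel C : closed C -> measurable (C : set (borel R n)).
Proof.
by move=> cC; rewrite -[C]setCK; apply: measurableC; apply: open_borel; rewrite openC.
Qed.

Lemma continuous_borel (f : E -> R) : continuous f ->
  measurable_fun setT (f : borel R n -> R).
Proof.
move=> /continuousP cf; apply: (measurability _ (RGenOpens.measurableE R)).
move=> _ [_ [a [b ->] <-]]; rewrite setTI; apply: open_borel.
exact/cf/interval_open.
Qed.

Lemma closed_sphere : closed (sphere : set E).
Proof.
have -> : sphere = (fun x : E => edot x x) @^-1` [set 1].
  by apply/seteqP; split=> x /sphereE.
apply: preimage_closed; first by move=> x _; exact: continuous_sqnorm.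
exact: closed_eq.
Qed.

Lemma closed_cball : closed (cball : set E).
Proof.
have -> : cball = (fun x : E => edot x x) @^-1` [set r | r <= 1].
  by apply/seteqP; split=> x /cballE.
apply: preimage_closed; first by move=> x _; exact: continuous_sqnorm.
exact: closed_le.
Qed.

Lemma le_esum_scale (T : choiceType) (I : set T) (a b : T -> R) (k : R) :
  0 <= k -> (forall i, 0 <= b i) -> (forall i, I i -> a i <= k * b i) ->
  (\esum_(i in I) (a i)%:E <= k%:E * \esum_(i in I) (b i)%:E)%E.
Proof.
move=> k0 b0 ab.
apply: (@le_trans _ _ (\esum_(i in I) (k%:E * (b i)%:E))%E).
  by apply: le_esum => i /ab; rewrite -EFinM lee_fin.
apply: ge_ereal_sup => _ [F [finF FI] <-].
rewrite -ge0_mule_fsumr //; apply: lee_wpmul2l => //.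
by apply: esum_ge; exists F.
Qed.

Lemma esum_subset (T : choiceType) (I J : set T) (a : T -> \bar R) :
  I `<=` J -> (\esum_(i in I) a i <= \esum_(i in J) a i)%E.
Proof.
move=> IJ; apply: ge_ereal_sup => _ [F [finF FI] <-].
by apply: esum_ge; exists F => //; split => //; exact: subset_trans IJ.
Qed.

(** Both measures are normalized by the same sum, based at o, so a bound between the weights passes
    to them. *)
Lemma patterson_approx_le X h s z k (U : set (borel R n)) : 0 <= k ->
  (forall x, X x -> U x ->
    (h (hdist x 0))%:num * expR (- s * hdist x 0) <=
    k * ((h (hdist x z))%:num * expR (- s * hdist x z))) ->
  (patterson_approx X h s 0 U <= k%:E * patterson_approx X h s z U)%E.
Proof.
move=> k0 hk; apply: le_esum_scale => // [x|x [Xx Ux]].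
  exact: patterson_weight_ge0.
rewrite mulrA ler_wpM2r ?hk // invr_ge0.
apply/fine_ge0/esum_ge0 => y _.
by rewrite lee_fin mulr_ge0 ?expR_ge0.
Qed.

Lemma patterson_approx_mono X h s z (U V : set (borel R n)) : U `<=` V ->
  (patterson_approx X h s z U <= patterson_approx X h s z V)%E.
Proof. by move=> UV; apply: esum_subset => x [Xx /UV]. Qed.

Lemma critical_exponent_ge0 X : 0 <= critical_exponent X.
Proof.
rewrite /critical_exponent.
set S := [set s : R | _]; have [->|/set0P S0] := eqVneq S set0.
  (* The infimum of the empty set is 0 by convention. *)
  by rewrite inf0.
by apply: lb_le_inf => // s [/ltW].
Qed.

Lemma continuous_maxB (T : topologicalType) (f g : T -> R) (b c : R) :
  continuous f -> continuous g ->
  continuous (fun r => Num.max (f r - b) (c - g r)).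
Proof.
move=> cf cg; apply: max_fun_continuous => r.
  by apply: cvgB; [exact: cf | exact: cvg_cst].
by apply: cvgB; [exact: cvg_cst | exact: cg].
Qed.

Lemma continuous_cutoff (T : topologicalType) (f : T -> R) (c : R) :
  continuous f -> continuous (fun r => Num.min 1 (Num.max 0 (1 - f r / c))).
Proof.
move=> cf; apply: min_fun_continuous => [r|]; first exact: cvg_cst.
apply: max_fun_continuous => r; first exact: cvg_cst.
apply: cvgB; first exact: cvg_cst.
by apply: cvgM; [exact: cf | exact: cvg_cst].
Qed.

Lemma lee_cvg_scale (u v : (\bar R)^nat) (c : R^nat) (u0 v0 : \bar R) (c0 : R) :
  v0 \is a fin_num -> u j @[j --> \oo] --> u0 -> v j @[j --> \oo] --> v0 ->
  c j @[j --> \oo] --> c0 -> (forall j, u j <= (c j)%:E * v j)%E ->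
  (u0 <= c0%:E * v0)%E.
Proof.
move=> v0fin cvgu cvgv cvgc uv.
(* Finiteness of the limit excludes the product of 0 and infinity. *)
have def0 : (c0%:E *? v0)%E by case: v0 v0fin {cvgv}.
have cvgc' : (c j)%:E @[j --> \oo] --> c0%:E.
  by apply: cvg_EFin => //; exact: nearW.
apply: (lee_cvg_to cvgu (cvgeM def0 cvgc' cvgv)).
exact: nearW.
Qed.

(* For small eps > 0, the mass near C of mu_o^s is at most
   e^(eps (t + s)) b^s times the mass of mu_z^s; a continuous cut-off equal to
   1 on C carries this to the weak limits. *)
Lemma patterson_density X (mu : E -> {finite_measure set borel R n -> \bar R})
    z C (b : R) :
  patterson_measure X mu -> X `<=` hspace -> hspace z -> 0 < b ->
  closed C -> C `<=` sphere ->
  (forall xi, C xi -> edot (xi - z) (xi - z) / (1 - edot z z) <= b) ->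
  (mu 0%R C <= (b `^ critical_exponent X)%:E * mu z setT)%E.
Proof.
move=> [h [s [hp [sgt _ scvg] hmu]]] hX hz b0 cC Csph hC.
set D := critical_exponent X in sgt scvg *.
have D0 : 0 <= D by exact: critical_exponent_ge0.
have h0 : hspace (0 : E) by apply/hspaceE; rewrite edot0l.
have mC := closed_borel cC.
have mB := closed_borel closed_cball.
have int1 (m : {measure set borel R n -> \bar R}) :
    (\int[m]_(y in cball) (cst 1 y)%:E = m cball)%E.
  exact: (etrans (integral_cst m mB 1%E) (mul1e _)).
have [t t0 wle] := patterson_weight_le hp hz.
have bound (eps : R) : 0 < eps ->
    (mu 0%R C <= (expR (eps * (t + D) + D * ln b))%:E * mu z setT)%E.
  move=> eps0; have [de de0 {}wle] := wle eps b eps0 b0.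
  (* F < [de] combines the two conditions on x in the weight estimate. On C both terms are at most
     0, so the cut-off f is 1 there, and f vanishes where F >= [de]. *)
  pose F y := Num.max (inv_poisson z y - b) (1 - edot y y).
  pose f y := Num.min 1 (Num.max 0 (1 - F y / de)).
  have cF : continuous F.
    exact: continuous_maxB (@continuous_inv_poisson R n z) continuous_sqnorm.
  have cf : continuous f by exact: continuous_cutoff.
  have mf : measurable_fun setT (f : borel R n -> R) := continuous_borel cf.
  pose U : set (borel R n) := [set y | F y < de].
  have mU : measurable U.
    apply: open_borel; apply: (open_comp (f := F) (D := [set r | r < de])).
      by move=> y _; exact: cF.
    exact: open_lt.
  have f0 y : 0 <= f y by rewrite /f le_min ler01 le_max lexx.
  have fC y : C y -> f y = 1.
    move=> Cy; have sy := Csph _ Cy; rewrite /f; apply/min_idPl.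
    rewrite le_max; apply/orP; right; rewrite lerBrDr gerDl.
    rewrite mulr_le0_ge0 ?invr_ge0 ?(ltW de0) // /F ge_max.
    rewrite inv_poisson_sphere // subr_le0 hC //=.
    by move/sphereE : sy => ->; rewrite subrr.
  have fU y : f y <= \1_U y.
    rewrite indicE; case: (boolP (y \in U)) => [_|]; first by rewrite /f ge_min lexx.
    rewrite notin_setE /U /= => /negP; rewrite -leNgt => Fy.
    rewrite /f ge_min; apply/orP; right; rewrite ge_max lexx /=.
    by rewrite subr_le0 ler_pdivlMr // mul1r.
  have intU (m : {measure set borel R n -> \bar R}) :
      (\int[m]_(y in cball) (f y)%:E <= m (U `&` cball))%E.
    rewrite -(integral_indic m mB mU); apply: ge0_le_integral => //.
    + by move=> y _; rewrite lee_fin.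
    + by apply/measurable_EFinP; exact: measurable_funTS.
    + by apply/measurable_EFinP; exact: measurable_indic.
    + by move=> y _; rewrite lee_fin.
  have [_ /(_ f (continuous_subspaceT cf)) lim0] := hmu 0%R h0.
  (* Testing with the constant 1 gives convergence of the total masses at z. *)
  have c1 : {within cball, continuous (cst 1 : E -> R)}.
    by apply: continuous_subspaceT; exact: cst_continuous.
  have [_ /(_ (cst 1) c1) limz] := hmu z hz.
  apply: (@le_trans _ _ (\int[mu 0%R]_(y in cball) (f y)%:E)%E).
    rewrite -[leLHS](_ : (\int[mu 0%R]_(y in cball) (\1_C y)%:E)%E = _); last first.
      rewrite integral_indic //; congr (mu 0%R _).
      by apply: setIidl => y /Csph; right.
    apply: ge0_le_integral => //.
    - apply/measurable_EFinP; exact: measurable_indic.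
    - apply/measurable_EFinP; exact: measurable_funTS.
    - move=> y _; rewrite lee_fin indicE; case: (boolP (y \in C)) => [|_] //.
      by rewrite inE => /fC ->.
  pose k r := expR (eps * (t + r) + r * ln b).
  apply: (@le_trans _ _ ((k D)%:E * \int[mu z]_(y in cball) (cst 1 y)%:E)%E); last first.
    apply: lee_wpmul2l; first by rewrite lee_fin expR_ge0.
    rewrite int1; apply: le_measure; rewrite ?inE //.
  have limk : k (s j) @[j --> \oo] --> k D.
    apply: (continuous_cvg _ (@continuous_expR R _)).
    apply: cvgD; last by apply: cvgM => //; exact: cvg_cst.
    apply: cvgM; first exact: cvg_cst.
    by apply: cvgD => //; exact: cvg_cst.
  apply: (lee_cvg_scale _ lim0 limz limk) => [|j].
    by rewrite int1; exact: fin_num_measure.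
  have sj0 : 0 <= s j by apply: (le_trans D0); exact: ltW.
  have le0 := intU (patterson_approx X h (s j) 0).
  have approx_le : (patterson_approx X h (s j) 0 (U `&` cball) <=
      (k (s j))%:E * patterson_approx X h (s j) z (U `&` cball))%E.
    apply: patterson_approx_le; first exact: expR_ge0.
    move=> x Xx [Ux _]; have : F x < de := Ux.
    rewrite /F gt_max => /andP[x1 x2]; apply: wle => //; first exact: hX.
    by rewrite addrC -ltrBlDr.
  apply: (le_trans le0); apply: (le_trans approx_le).
  apply: lee_wpmul2l; first by rewrite lee_fin expR_ge0.
  rewrite (int1 (patterson_approx X h (s j) z)).
  by apply: patterson_approx_mono => x [].
have [M ME] : exists M, mu z setT = M%:E.
  by exists (fine (mu z setT)); rewrite fineK //; exact: fin_num_measure.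
have [m mE] : exists m, mu 0%R C = m%:E.
  by exists (fine (mu 0%R C)); rewrite fineK //; exact: fin_num_measure.
rewrite ME mE -EFinM lee_fin /powR gt_eqF // in bound *.
(* As eps tends to 0, the factor tends to e^(D ln b) = b^D. *)
have lim0 : expR (eps * (t + D) + D * ln b) * M @[eps --> 0^'+] -->
    expR (0 * (t + D) + D * ln b) * M.
  apply: cvgM; last exact: cvg_cst.
  apply: (continuous_cvg _ (@continuous_expR R _)).
  apply: cvgD; last exact: cvg_cst.
  apply: cvgM; last exact: cvg_cst.
  exact: cvg_within.
rewrite mul0r add0r in lim0.
apply: (cvgr_to_ge lim0); near=> eps.
by rewrite -lee_fin EFinM; apply: bound; near: eps; exact: nbhs_right_gt.
Unshelve. all: by end_near. Qed.

End PattersonDensity.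

(** * Chords, spherical diameter and the mass of a shadow *)

Lemma normr_sin_le {R : realType} (a : R) : 0 <= a -> `|sin a| <= a.
Proof.
move=> a0.
have [|c _] := @MVT_segment R sin cos 0 a a0.
  by apply: continuous_subspaceT; exact: continuous_sin.
rewrite sin0 !subr0 => ->; rewrite normrM (ger0_norm a0).
by rewrite ler_piMl ?cos_max.
Qed.

(** The left side is 4 sin^2(a/2). *)
Lemma cos_ge_quadratic {R : realType} (a : R) : 0 <= a -> 2 - 2 * cos a <= a ^+ 2.
Proof.
move=> a0; have h0 : 0 <= a / 2 by rewrite divr_ge0.
have -> : a = (a / 2) *+ 2 by rewrite -mulr_natr; field.
rewrite cos_mulr2n cos2sin2.
have : `|sin (a / 2)| ^+ 2 <= (a / 2) ^+ 2.
  by rewrite ler_pXn2r ?nnegrE // normr_sin_le.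
rewrite real_normK ?num_real // exprMn_n -mulr_natr; lra.
Qed.

Lemma spherical_diam_ub {R : realType} {n : nat} (S : set 'rV[R]_n.+1) xi eta :
  S `<=` sphere -> S xi -> S eta ->
  0 <= acos (edot xi eta) <= spherical_diam S.
Proof.
move=> Ss Sxi Seta; rewrite acos_ge0 ?edot_sphere ?Ss //=; try exact: Ss.
apply: ub_le_sup; last by exists xi, eta.
(* All angles are at most pi, so the supremum is a genuine one. *)
exists pi => _ [a [b [Sa Sb ->]]].
by apply: acos_lepi; apply: edot_sphere; exact: Ss.
Qed.

(** The left side is the squared chord, which is at most the squared angle. *)
Lemma chord_le_diam {R : realType} {n : nat} (S : set 'rV[R]_n.+1) xi eta :
  S `<=` sphere -> S xi -> S eta ->
  2 - 2 * edot xi eta <= spherical_diam S ^+ 2.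
Proof.
move=> Ss Sxi Seta.
have /andP[a0 ad] := spherical_diam_ub Ss Sxi Seta.
have e1 := edot_sphere (Ss _ Sxi) (Ss _ Seta).
have := cos_ge_quadratic a0; rewrite acosK ?in_itv //= => /le_trans; apply.
by rewrite ler_pXn2r ?nnegrE // (le_trans a0).
Qed.

(* Seen from z = (1 - r) xi, every point at distance at most r from xi has
   Poisson kernel at least 1/r. *)
Lemma mass_le_radius {R : realType} {n : nat} (X S : set 'rV[R]_n.+1)
    (mu : 'rV[R]_n.+1 -> {finite_measure set borel R n -> \bar R}) (K r : R) xi :
  patterson_measure X mu -> X `<=` hspace ->
  (forall z, hspace z -> (mu z setT <= K%:E)%E) ->
  S `<=` sphere -> measurable (S : set (borel R n)) -> sphere xi ->
  0 < r <= 1 -> (forall eta, S eta -> 2 - 2 * edot xi eta <= r ^+ 2) ->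
  (mu 0%R S <= (r `^ critical_exponent X * K)%:E)%E.
Proof.
move=> hmu hX hK Ss mS sxi /andP[r0 r1] hS.
have /sphereE xi1 := sxi.
(* The density bound is for closed sets, so S is enlarged to a closed cap. *)
pose C : set 'rV[R]_n.+1 := sphere `&` [set eta | 2 - 2 * edot xi eta <= r ^+ 2].
have cC : closed C.
  apply: closedI; first exact: closed_sphere.
  have -> : [set eta | 2 - 2 * edot xi eta <= r ^+ 2] =
      edot xi @^-1` [set c | (2 - r ^+ 2) / 2 <= c].
    apply/seteqP; split=> eta /=; lra.
  by apply: preimage_closed; [move=> eta _; exact: continuous_edotl | exact: closed_ge].
pose z := (1 - r) *: xi.
have zz : edot z z = (1 - r) ^+ 2 by rewrite !edotE xi1; ring.
have hz : hspace z by apply/hspaceE; rewrite zz; nra.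
apply: (@le_trans _ _ (mu 0%R C)).
  apply: le_measure; rewrite ?inE //; first exact: closed_borel.
  by move=> eta Seta; split; [exact: Ss | exact: hS].
apply: (@le_trans _ _ ((r `^ critical_exponent X)%:E * mu z setT)%E); last first.
  rewrite EFinM; apply: lee_wpmul2l; last exact: hK.
  by rewrite lee_fin powR_ge0.
apply: patterson_density => //; first by move=> eta [].
move=> eta [/sphereE eta1 /= hr].
(* With u = 2 - 2 xi.eta <= r^2, |eta - z|^2 = r^2 + (1 - r)u <= r^2 (2 - r) = r(1 - |z|^2). *)
rewrite ler_pdivrMr; last by rewrite zz; nra.
rewrite edot_sub /z !edotE xi1 eta1 (edotC eta).
nra.
Qed.

Theorem theorem7p7 (R : realType) (n : nat) (hn : (1 <= n)%N)
    (K l : R) (hl : 0 < l) :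
  exists2 A : R, 0 < A &
    forall (L X : set 'rV[R]_n.+1)
           (mu : 'rV[R]_n.+1 -> {finite_measure set (borel R n) -> \bar R}),
      L `<=` sphere -> closed L ->
      unif_distributed L X -> bounded_type X ->
      patterson_measure X mu ->
      (forall z, hspace z -> (mu z setT <= K%:E)%E) ->
      forall x, X x -> x <> 0 ->
        (mu 0%R (shadow x l) <=
           (A * spherical_diam (shadow x l) `^ critical_exponent X)%:E)%E.
Proof.
exists (`|K| + 1); first by rewrite ltr_wpDl.
move=> L X mu _ _ [XL _ _ _] _ hmu hK x Xx x0.
have hX : X `<=` hspace by apply: subset_trans XL _; exact: hull_hspace.
have [U oU sE] := shadow_open (hX _ Xx) hl.
set S := shadow x l in sE *.
have Ss : S `<=` sphere by rewrite sE => y [].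
have mS : measurable (S : set (borel R n)).
  rewrite sE; apply: measurableI; last exact: open_borel.
  by apply: closed_borel; exact: closed_sphere.
set D := critical_exponent X; set d := spherical_diam S.
have D0 : 0 <= D by exact: critical_exponent_ge0.
have h0 : hspace (0 : 'rV[R]_n.+1) by apply/hspaceE; rewrite edot0l.
have muK : (mu 0%R S <= K%:E)%E.
  apply: le_trans (hK _ h0); apply: le_measure; rewrite ?inE //.
have K0 : 0 <= K by rewrite -lee_fin; apply: le_trans muK.
rewrite (ger0_norm K0).
have [S0|/set0P[xi Sxi]] := eqVneq S set0.
  by rewrite S0 measure0 lee_fin mulr_ge0 ?powR_ge0 // addr_ge0.
have d0 : 0 <= d.
  by have /andP[/le_trans h /h] := spherical_diam_ub Ss Sxi Sxi.
have bound r : d <= r -> 0 < r -> r <= 1 -> (mu 0%R S <= (r `^ D * K)%:E)%E.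
  move=> dr r0 r1; apply: (@mass_le_radius _ _ X S mu K r xi) => //.
  - exact: Ss.
  - by rewrite r0.
  - move=> eta Seta; apply: le_trans (chord_le_diam Ss Sxi Seta) _.
    by rewrite ler_pXn2r ?nnegrE // ltW.
have KA c : 0 <= c -> ((c * K)%:E <= ((K + 1) * c)%:E)%E.
  by move=> c0; rewrite lee_fin mulrC ler_wpM2r // lerDl.
(* For exponent 0 the power is 1, even at d = 0, and the mass bound suffices. *)
have [D00|Dn0] := eqVneq D 0.
  by rewrite D00 powRr0 mulr1; apply: le_trans muK _; rewrite lee_fin lerDl.
have [d1|d1] := leP 1 d.
  apply: le_trans muK _; rewrite lee_fin.
  have : 1 <= d `^ D by rewrite -(powRr0 d) ler_powR.
  by have := powR_ge0 d D; nra.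
(* For 0 < d < 1 take r = d in [bound]. For d = 0 the right side is 0, as D > 0, and r tends to 0
   instead. *)
have [dd0|dn0] := eqVneq d 0; last first.
  apply: le_trans (KA _ (powR_ge0 _ _)); apply: bound => //.
    by rewrite lt_neqAle eq_sym dn0.
  exact: ltW.
rewrite dd0 powR0 // mulr0.
have D0' : 0 < D by rewrite lt_neqAle eq_sym Dn0.
have [m mE] : exists m, mu 0%R S = m%:E.
  by exists (fine (mu 0%R S)); rewrite fineK //; exact: fin_num_measure.
rewrite mE lee_fin.
have lim0 : r `^ D * K @[r --> 0^'+] --> 0 * K.
  by apply: cvgM; [exact: powR_cvg0 | exact: cvg_cst].
rewrite mul0r in lim0.
apply: (cvgr_to_ge lim0); near=> r.
rewrite -lee_fin -mE; apply: bound; first by rewrite dd0 ltW.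
  by near: r; exact: nbhs_right_gt.
by near: r; exact: nbhs_right_le.
Unshelve. all: by end_near. Qed.
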